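(* Let $\mathcal{A}$ be a non-empty finite set, let $(f_w)_{w\in\mathcal{A}}$ be similitudes $f_w:[0,1]\to[0,1]$, $f_w(x)=r_wx+b_w$, with $r_w\in(0,1)$ and $b_w\in[0,1]$, and let $F\subset[0,1]$ be the self-similar set associated with them, i.e. the non-empty compact set with $F=\bigcup_{w\in\mathcal{A}}f_w(F)$. Suppose the images $(f_w([0,1]))_{w\in\mathcal{A}}$ are pairwise disjoint except at the endpoints. Then the Hausdorff dimension $\dim F$ is the unique solution $s$ in $[0,1]$ of the equation $$\sum_{w\in\mathcal{A}}r_w^{\,s}=1.$$
   Context: ''Pairwise disjoint except at the endpoints'' means that for distinct $w,w'\in\mathcal{A}$ the closed intervals $f_w([0,1])$ and $f_{w'}([0,1])$ intersect at most in endpoints, i.e. their interiors are disjoint. *)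

(* Defs.v *)
From HB Require Import structures.
From mathcomp Require Import all_boot all_order all_algebra.
From mathcomp Require Import all_classical all_reals all_analysis.

Set Implicit Arguments.
Unset Strict Implicit.
Unset Printing Implicit Defensive.

Import Order.TTheory GRing.Theory Num.Theory.
Import numFieldNormedType.Exports.

Local Open Scope classical_set_scope.
Local Open Scope ring_scope.

Section hausdorff.
Context {R : realType}.
Implicit Types (s d : R) (U E : set R).
Local Open Scope ereal_scope.

(* Note that [diam set0 = -oo]. *)
Definition diam U : \bar R :=
  ereal_sup [set `|p.1 - p.2|%:E | p in U `*` U].

(* The empty set has weight 0 for every exponent, including [s = 0], where a
   non-empty set has weight 1: [hausdorff_measure 0] is the counting measure. *)
Definition diam_pow s U : \bar R :=
  if U == set0 then 0 else diam U `^ s.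

(* Covers are indexed by [nat]; finite covers are padded with [set0]. *)
Definition delta_covers d E : set ((set R)^nat) :=
  [set U | E `<=` \bigcup_i U i /\ forall i, diam (U i) <= d%:E].

Definition hausdorff_content s d E : \bar R :=
  ereal_inf [set \sum_(0 <= i <oo) diam_pow s (U i) | U in delta_covers d E].

Definition hausdorff_measure s E : \bar R :=
  ereal_sup [set hausdorff_content s d E | d in [set d | (0 < d)%R]].

Definition hausdorff_dim E : \bar R :=
  ereal_inf [set s%:E | s in [set s | (0 <= s)%R /\ hausdorff_measure s E = 0]].

End hausdorff.

Definition similitude {R : realType} (r b : R) : R -> R := fun x => r * x + b.

(* When [A] is non-empty and the [f w] are contractions, exactly one [F]
   satisfies this. *)
Definition self_similar_set {R : realType} {A : finType} (f : A -> R -> R)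
    (F : set R) : Prop :=
  [/\ F !=set0, compact F & F = \bigcup_(w in [set: A]) (f w @` F)].

(* Main.v *)
(** Let [s] solve [\sum_w r w `^ s = 1] and let the natural measure give weight
    [\prod_i r (w_i) `^ s] to each cylinder.  Covering [F] by the [n]-th level
    cylinders gives the upper bound.  For the lower bound, the level [n]
    approximations of the natural measure satisfy a uniform Frostman estimate
    [mu_n [x, y] <= C * d `^ s] on intervals of length [4 * d], as soon as [d]
    exceeds the size of the level [n] cylinders.  It is proved by induction on [n]:
    non-overlap enters only through the superadditivity of the length of the
    intersection with the images, so no counting of cylinders is needed.  Summing the estimate over a finite subcover of a slightly
    enlarged open cover gives a positive lower bound for the content. *)
Require Import Defs.
From HB Require Import structures.
From mathcomp Require Import all_boot all_order all_algebra.
From mathcomp Require Import all_classical all_reals all_analysis.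
From mathcomp Require Import ring lra.

Import Order.TTheory GRing.Theory Num.Theory.
Import numFieldNormedType.Exports.

Local Open Scope classical_set_scope.
Local Open Scope ring_scope.

(** * Length of the intersection of two intervals *)

(** Truncating at 0 covers disjoint intervals, and makes one with reversed endpoints count as
    empty. *)
Definition overlap {R : realType} (a b x y : R) : R :=
  Num.max 0 (Num.min b y - Num.max a x).

Lemma overlap_scale {R : realType} (k c a b x y : R) : 0 < k ->
  overlap (k * a + c) (k * b + c) (k * x + c) (k * y + c) =
  k * overlap a b x y.
Proof.
move=> k0; rewrite /overlap -addr_maxl -addr_minl -!minr_pMr ?ltW//.
rewrite -!maxr_pMr ?ltW// [RHS]maxr_pMr ?ltW// mulr0.
by congr Num.max; rewrite mulrBr; lra.
Qed.

Lemma overlap_ge0 {R : realType} (a b x y : R) : 0 <= overlap a b x y.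
Proof. by rewrite /overlap le_max lexx. Qed.

Lemma overlap_le {R : realType} (a b x y : R) : a <= b -> overlap a b x y <= b - a.
Proof.
move=> ab; rewrite /overlap ge_max subr_ge0 ab /= lerB//.
- by rewrite ge_min lexx.
- by rewrite le_max lexx.
Qed.

Lemma overlap_subset {R : realType} (a b x y : R) :
  a <= x -> x <= y -> y <= b -> overlap a b x y = y - x.
Proof.
move=> ax xy yb; rewrite /overlap (min_idPr yb) (max_idPr ax).
by apply/max_idPr; rewrite subr_ge0.
Qed.

Lemma lebesgue_measure_overlap {R : realType} (a b x y : R) :
  lebesgue_measure (`]a, b[%classic `&` `]x, y[%classic) =
  (overlap a b x y)%:E.
Proof.
have -> : `]a, b[%classic `&` `]x, y[%classic =
    `](Num.max a x), (Num.min b y)[%classic.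
  apply/seteqP; split => z /=; rewrite !in_itv/= gt_max lt_min.
    by move=> [/andP[-> ->] /andP[-> ->]].
  by move=> /andP[/andP[-> ->] /andP[-> ->]].
rewrite lebesgue_measure_itv/= lte_fin /overlap.
have [h|h] := ltP (Num.max a x) (Num.min b y).
  by rewrite [in RHS](@max_idPr _ _ 0 _ _) ?subr_ge0 ?ltW.
by rewrite [in RHS](@max_idPl _ _ 0 _ _) ?subr_le0.
Qed.

(** Overlaps are Lebesgue measures of intersections of open intervals, so additivity over the
    disjoint pieces and monotonicity suffice. *)
Lemma sum_overlap_le {R : realType} {A : finType} (x y : A -> R) (a b c d : R) :
  (forall w, `]x w, y w[%classic `<=` `]c, d[%classic) ->
  (forall w w', w <> w' -> `]x w, y w[%classic `&` `]x w', y w'[%classic = set0) ->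
  \sum_(w : A) overlap a b (x w) (y w) <= overlap a b c d.
Proof.
move=> sub disj; rewrite -lee_fin -sumEFin.
under eq_bigr do rewrite -lebesgue_measure_overlap.
rewrite -lebesgue_measure_overlap.
set G := fun w => `]a, b[%classic `&` `]x w, y w[%classic.
have mG w : measurable (G w) by apply: measurableI; exact: measurable_itv.
have -> : \sum_(w : A) lebesgue_measure (G w) =
          lebesgue_measure (\bigcup_(w in [set: A]) G w).
  rewrite measure_fin_bigcup; [|exact: finite_finset| |by move=> w _; exact: mG];
    last first.
  - apply/trivIsetP => w w' _ _ /eqP ww'.
    by rewrite /G setIACA setIid (disj _ _ ww') setI0.
  - rewrite fsbig_finite/=; last exact: finite_finset.
    apply: perm_big; apply: uniq_perm.
    + exact: index_enum_uniq.
    + exact: finmap.fset_uniq.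
    + move=> w; rewrite mem_index_enum in_fset_set; last exact: finite_finset.
      by rewrite in_setT.
apply: le_measure; rewrite ?inE.
- by apply: fin_bigcup_measurable => [|w _]; [exact: finite_finset|exact: mG].
- by apply: measurableI; exact: measurable_itv.
- by move=> z [w _ [? ?]]; split => //; exact: (sub w).
Qed.

(** * Geometric sequences *)

Lemma exists_expr_le {R : realType} (k : R) (l : seq nat) (e : nat -> R) :
  0 <= k < 1 -> (forall i, 0 < e i) ->
  exists n, forall i, i \in l -> k ^+ n <= e i.
Proof.
move=> /andP[k0 k1] e0; elim: l => [|j l [n IH]]; first by exists 0%N.
have : \forall m \near \oo, k ^+ m < e j.
  have kn : (fun m => k ^+ m) @ \oo --> (0 : R).
    have := @cvg_geometric R 1 k; rewrite ger0_norm// => /(_ k1).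
    by rewrite /geometric/=; under eq_fun do rewrite mul1r.
  by apply: (cvgr_lt _ kn); exact: e0.
move=> [m _ km]; exists (maxn m n) => i; rewrite inE => /predU1P[->|il].
  by apply/ltW/km => /=; exact: leq_maxl.
apply: le_trans (IH i il); apply: ler_wiXn2l => //; [exact: ltW|exact: leq_maxr].
Qed.

Lemma sum_half_pow_le1 {R : realType} (N : nat) :
  \sum_(i < N) (2^-1 : R) ^+ i.+1 <= 1.
Proof.
suff -> : \sum_(i < N) (2^-1 : R) ^+ i.+1 = 1 - 2^-1 ^+ N.
  by rewrite gerBl exprn_ge0// invr_ge0.
elim: N => [|N IH]; first by rewrite big_ord0 expr0 subrr.
by rewrite big_ord_recr/= IH exprSr; lra.
Qed.

(** * Diameters and Hausdorff content *)

Lemma diam_ge0 {R : realType} (U : set R) : U !=set0 -> (0 <= diam U)%E.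
Proof.
move=> [u Uu]; apply: ereal_sup_ubound; exists (u, u) => //=.
by rewrite subrr normr0.
Qed.

Lemma diam_pow_ge0 {R : realType} (s : R) (U : set R) : (0 <= diam_pow s U)%E.
Proof. by rewrite /diam_pow; case: ifP => // _; exact: poweR_ge0. Qed.

(** The pair is a centre in [U] and the radius [diam U]; a radius at most 1 has a smaller power at
    the larger exponent. Radius 0 serves the empty set, as [s > 0] makes its power 0. *)
Lemma diam_pow_ball {R : realType} (s t : R) (U : set R) :
  0 < s -> t <= s -> (diam U <= 1%:E)%E ->
  exists p : R * R, [/\ 0 <= p.2 <= 1, U `<=` `[p.1 - p.2, p.1 + p.2]%classic
    & ((p.2 `^ s)%:E <= diam_pow t U)%E].
Proof.
move=> s0 ts dU; have [->|/eqP U0] := eqVneq U set0.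
  exists (0, 0); split => /=; rewrite ?lexx ?ler01//.
  by rewrite /diam_pow eqxx powR0// gt_eqF.
have /set0P Un : U != set0 by exact/eqP.
have := diam_ge0 U Un; have [u Uu] := Un.
move: dU; case E : (diam U) => [d| |]//; rewrite !lee_fin => d1 d0.
exists (u, d); split => /=; first by rewrite d0 d1.
  move=> z Uz; have : (`|z - u|%:E <= diam U)%E.
    by apply: ereal_sup_ubound; exists (z, u).
  by rewrite E lee_fin /= in_itv/= ler_distlC => /andP[? ?]; apply/andP; split; lra.
rewrite /diam_pow ifF; last exact/eqP.
rewrite E poweR_EFin lee_fin; have [->|d0'] := eqVneq d 0.
  by rewrite powR0 ?powR_ge0// gt_eqF.
by apply: ger_powR => //; rewrite lt_neqAle eq_sym d0' d0.
Qed.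

Lemma diam_itv_le {R : realType} (x l : R) :
  (diam `[x, (x + l)%R]%classic <= l%:E)%E.
Proof.
apply: ge_ereal_sup => _ [[y z] /= [+ +] <-]; rewrite !in_itv/= lee_fin.
by move=> /andP[? ?] /andP[? ?]; rewrite ler_norml; apply/andP; split; lra.
Qed.

Lemma diam_pow_itv_le {R : realType} (t x l : R) : 0 <= t -> 0 <= l ->
  (diam_pow t `[x, (x + l)%R]%classic <= (l `^ t)%:E)%E.
Proof.
move=> t0 l0; have xl : `[x, x + l]%classic !=set0.
  by exists x; rewrite /= in_itv/= lexx lerDl.
have /set0P/negbTE xl0 := xl; rewrite /diam_pow xl0.
have := diam_ge0 _ xl; have := diam_itv_le x l.
case: (diam _) => [d| |]//; rewrite !lee_fin => dl d0.
by rewrite ge0_ler_powR.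
Qed.

(** Here a pair encodes an interval by its left endpoint and its length; padding by empty sets adds
    no weight. *)
Lemma hausdorff_content_le_sum {R : realType} (t d : R) (F : set R)
    (l : seq (R * R)) : 0 <= t ->
  (forall x, F x -> exists2 q, q \in l & q.1 <= x <= q.1 + q.2) ->
  (forall q, q \in l -> 0 <= q.2 <= d) ->
  (hausdorff_content t d F <= (\sum_(q <- l) q.2 `^ t)%:E)%E.
Proof.
move=> t0 Fl l0.
pose U i := if (i < size l)%N then
  `[(nth (0, 0) l i).1, (nth (0, 0) l i).1 + (nth (0, 0) l i).2]%classic
  else set0 : set R.
apply: (@le_trans _ _ (\sum_(0 <= i <oo) diam_pow t (U i))%E).
  apply: ereal_inf_lbound; exists U => //; split => [x /Fl[q ql qx]|i].
    exists (index q l) => //.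
    by rewrite /U index_mem ql nth_index//= in_itv.
  rewrite /U; case: ifPn => il.
    apply: le_trans (diam_itv_le _ _) _.
    by have /andP[_] := l0 _ (mem_nth (0, 0) il); rewrite lee_fin.
  by apply: ge_ereal_sup => _ [[y z] [[]]].
rewrite (nneseries_split 0 (size l)); last by move=> *; exact: diam_pow_ge0.
rewrite add0n eseries0 ?adde0; last first.
  by move=> i li _; rewrite /U ltnNge li /diam_pow eqxx.
rewrite -sumEFin (big_nth (0, 0)) !big_mkord; apply: lee_sum => i _.
rewrite /U ltn_ord; apply: diam_pow_itv_le => //.
by have /andP[] := l0 _ (mem_nth (0, 0) (ltn_ord i)).
Qed.

Lemma hausdorff_content_ge0 {R : realType} (t d : R) (F : set R) :
  (0 <= hausdorff_content t d F)%E.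
Proof.
apply: le_ereal_inf_tmp => _ [U _ <-].
by apply: nneseries_ge0 => i _ _; exact: diam_pow_ge0.
Qed.

(** * Powers as functions of the exponent *)

Lemma ltr_powR_expnt {R : realType} (a x y : R) : 0 < a < 1 -> x < y ->
  a `^ y < a `^ x.
Proof.
move=> /andP[a0 a1] xy; rewrite -(subrK x y) powRD; last first.
  by apply/implyP => _; exact: lt0r_neq0.
rewrite gtr_pMl ?powR_gt0//.
have <- : 1 `^ (y - x) = 1 :> R by rewrite powR1.
by rewrite gt0_ltr_powR ?subr_gt0 ?nnegrE ?ler01 ?(ltW a0).
Qed.

Lemma continuous_powR_expnt {R : realType} (a : R) : 0 < a ->
  continuous (fun x : R => a `^ x).
Proof.
move=> a0 x; rewrite /powR (gt_eqF a0)/=.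
apply: (@continuous_comp _ _ _ (fun x : R => x * ln a) expR).
  exact: mulrr_continuous.
exact: continuous_expR.
Qed.

(** * Approximations of the self-similar measure *)

(* The integral of [g] against the [n]-th approximation, started at the Dirac
   mass at [x0], of the self-similar measure with weights [p]. *)
Fixpoint transfer {R : realType} {A : finType} (p : A -> R) (f : A -> R -> R)
    (x0 : R) (n : nat) (g : R -> R) : R :=
  if n is m.+1 then \sum_w p w * transfer p f x0 m (g \o f w) else g x0.

(** The approximating measure is carried by images of [x0] under compositions of the maps, all of
    which lie in [F]. *)
Lemma le_transfer {R : realType} {A : finType} (p : A -> R) (f : A -> R -> R)
    (F : set R) x0 n (g h : R -> R) :
  (forall w, 0 <= p w) -> (forall w, f w @` F `<=` F) -> F x0 ->
  (forall x, F x -> g x <= h x) -> transfer p f x0 n g <= transfer p f x0 n h.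
Proof.
move=> p0 fF Fx0; elim: n g h => [|n IH] g h gh /=; first exact: gh.
apply: ler_sum => w _; apply: ler_wpM2l => //; apply: IH => x Fx /=.
by apply: gh; apply: (fF w); exists x.
Qed.

Lemma transfer_cst {R : realType} {A : finType} (p : A -> R) (f : A -> R -> R)
    x0 n (c : R) :
  \sum_w p w = 1 -> transfer p f x0 n (fun=> c) = c.
Proof.
move=> p1; elim: n => [//|n IH] /=.
by under eq_bigr do rewrite IH; rewrite -mulr_suml p1 mul1r.
Qed.

Lemma transfer_sum {R : realType} {A : finType} (p : A -> R) (f : A -> R -> R)
    x0 n (I : Type) (l : seq I) (g : I -> R -> R) :
  transfer p f x0 n (fun x => \sum_(i <- l) g i x) =
  \sum_(i <- l) transfer p f x0 n (g i).
Proof.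
elim: n g => [//|n IH] g /=; rewrite exchange_big/=; apply: eq_bigr => w _.
by rewrite -mulr_sumr -(IH (fun i => g i \o f w)).
Qed.

Lemma indic_itv_similitude {R : realType} (k c a b : R) : 0 < k ->
  \1_(`[a, b]%classic) \o similitude k c =
  \1_(`[(a - c) / k, (b - c) / k]%classic) :> (R -> R).
Proof.
move=> k0; apply/funext => x /=; rewrite !indicE; congr (_%:R); congr nat_of_bool.
apply/idP/idP; rewrite !inE/= !in_itv/= /similitude.
  by rewrite ler_pdivrMr// ler_pdivlMr// => /andP[? ?]; apply/andP; split; lra.
by rewrite ler_pdivrMr// ler_pdivlMr// => /andP[? ?]; apply/andP; split; lra.
Qed.

(** * Lengths of the non-overlapping images *)

Section iterated_function_system.
Context {R : realType} {A : finType} (r b : A -> R).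
Hypothesis r_bounds : forall w, 0 < r w < 1.
Hypothesis f_maps : forall w,
  similitude (r w) (b w) @` `[0, 1]%classic `<=` `[0, 1]%classic.
Hypothesis images_disjoint : forall w w', w <> w' ->
  interior (similitude (r w) (b w) @` `[0, 1]%classic) `&`
  interior (similitude (r w') (b w') @` `[0, 1]%classic) = set0.

Let r_gt0 w : 0 < r w. Proof. by have /andP[] := r_bounds w. Qed.

Lemma similitude_image_itv w :
  `]b w, (b w + r w)[%classic `<=` similitude (r w) (b w) @` `]0, 1[%classic.
Proof.
move=> x /=; rewrite in_itv/= => /andP[bx xb].
exists ((x - b w) / r w); last by rewrite /similitude mulrC divfK ?gt_eqF// subrK.
by rewrite /= in_itv/= divr_gt0 ?subr_gt0//= ltr_pdivrMr// mul1r ltrBlDl.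
Qed.

Lemma image_bounds w : 0 <= b w /\ b w + r w <= 1.
Proof.
have f0 : `[0, 1]%classic (b w : R).
  apply: (@f_maps w); exists 0; last by rewrite /similitude mulr0 add0r.
  by rewrite /= in_itv/= lexx ler01.
have f1 : `[0, 1]%classic (b w + r w : R).
  apply: (@f_maps w); exists 1; last by rewrite /similitude mulr1 addrC.
  by rewrite /= in_itv/= lexx ler01.
by move: f0 f1; rewrite /= !in_itv/= => /andP[? _] /andP[_ ?].
Qed.

(** The open intervals between the image endpoints lie in the interiors of the images, hence are
    disjoint. All later uses of non-overlap go through this bound. *)
Lemma sum_overlap_images a c :
  \sum_w overlap a c (b w) (b w + r w) <= overlap a c 0 1.
Proof.
have sub w : `]b w, (b w + r w)[%classic `<=`
    interior (similitude (r w) (b w) @` `[0, 1]%classic).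
  rewrite -open_subsetE; last exact: itv_open.
  apply: subset_trans (@similitude_image_itv w) _; apply: image_subset.
  exact: subset_itv_oo_cc.
apply: sum_overlap_le => [w|w w' ww'].
  have [b0 b1] := image_bounds w; move=> x /=.
  by rewrite !in_itv/= => /andP[? ?]; apply/andP; split; lra.
rewrite -subset0 -(images_disjoint w w' ww'); apply: setISS; exact: sub.
Qed.

Lemma sum_ratio_le1 : \sum_w r w <= 1.
Proof.
have := sum_overlap_images 0 1; rewrite overlap_subset ?ler01// subr0.
apply: le_trans; apply: ler_sum => w _; have [b0 b1] := image_bounds w.
by rewrite overlap_subset ?lerDl// ?(ltW (r_gt0 w))// addrAC subrr add0r.
Qed.

(** * Frostman estimate *)

(* Thickening [[x, y]] by [d] makes the bound reproduce itself exactly under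
   rescaling by [r w], since [r w `^ s * (d / r w) `^ (s - 1) = r w * d `^ (s - 1)]
   and lengths scale by [r w]. *)
Lemma mass_itv_le s (F : set R) (x0 rmin rmax : R) n (d x y : R) :
  let f w := similitude (r w) (b w) in let p w := r w `^ s in
  \sum_w p w = 1 -> s <= 1 ->
  (forall w, f w @` F `<=` F) -> F `<=` `[0, 1]%classic -> F x0 ->
  0 < rmin -> (forall w, rmin <= r w <= rmax) ->
  rmax ^+ n <= d <= rmin^-1 ->
  transfer p f x0 n \1_(`[x, y]%classic) <=
  (rmin * d) `^ (s - 1) * overlap (x - d) (y + d) 0 1.
Proof.
move=> f p p1 s1 fF F01 Fx0 rmin0 rr.
(* At scale [e >= 1] the total mass 1 suffices: if [[u, v]] meets [F], its thickening contains
   [[0, 1]], and [rmin * e <= 1] with [s <= 1] makes the factor at least 1. Otherwise the mass is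
   0. *)
have fin_mass k e u v : 1 <= e -> e <= rmin^-1 ->
    transfer p f x0 k \1_(`[u, v]%classic) <=
    (rmin * e) `^ (s - 1) * overlap (u - e) (v + e) 0 1.
  move=> e1 ermin; have e0 : 0 < e by exact: (lt_le_trans _ e1).
  have p0 w : 0 <= p w by exact: powR_ge0.
  have [[z [Fz]]|uvF] := pselect (exists z, F z /\ `[u, v]%classic z).
    rewrite /= in_itv/= => /andP[uz zv].
    have := F01 z Fz; rewrite /= in_itv/= => /andP[z0 z1].
    rewrite overlap_subset; [|lra|exact: ler01|lra].
    rewrite subr0 mulr1 -[leLHS]/(transfer p f x0 k _).
    apply: (@le_trans _ _ 1).
      rewrite -[leRHS](transfer_cst p f x0 k 1 p1); apply: (@le_transfer _ _ _ _ F) => //.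
    rewrite -[leLHS](powRr0 (rmin * e)); apply: ger_powR; last by rewrite subr_le0.
    by rewrite mulr_gt0//= mulrC -ler_pdivlMr// mul1r.
  apply: (@le_trans _ _ 0); last by rewrite mulr_ge0 ?powR_ge0 ?overlap_ge0.
  rewrite -[leRHS](transfer_cst p f x0 k 0 p1); apply: (@le_transfer _ _ _ _ F) => // t Ft.
  rewrite indicE; case: (boolP (t \in _)) => //; rewrite inE => uvt.
  by exfalso; apply: uvF; exists t.
elim: n d x y => [|n IH] d x y /andP[nd drmin].
  by apply: fin_mass => //; rewrite -(expr0 rmax).
have [d1|d1] := leP 1 d; first exact: fin_mass.
have d0 : 0 < d.
  apply: (lt_le_trans _ nd); rewrite exprn_gt0//.
  have [w _] : exists w : A, True.
    case: (pickP (fun _ : A => true)) => [w _|A0]; first by exists w.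
    by have := @oner_neq0 R; rewrite -p1 big_pred0 ?eqxx.
  by have /andP[_] := rr w; exact: lt_le_trans (r_gt0 w).
rewrite /=; apply: (@le_trans _ _ (\sum_w (rmin * d) `^ (s - 1) *
    overlap (x - d) (y + d) (b w) (b w + r w))); last first.
  rewrite -mulr_sumr ler_wpM2l ?powR_ge0//; exact: sum_overlap_images.
apply: ler_sum => w _; rewrite indic_itv_similitude//.
have /andP[rw rw'] := rr w.
(* Since [d < 1], one rescaling overshoots 1 by a factor at most [rmin^-1]; this is the upper limit
   on the scale in the statement. *)
have step : rmax ^+ n <= d / r w <= rmin^-1.
  rewrite ler_pdivlMr// ler_pdivrMr//; apply/andP; split.
    apply: le_trans nd; rewrite exprSr ler_wpM2l// exprn_ge0//.
    by apply: le_trans rw'; exact: ltW.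
  by rewrite mulrC (le_trans (ltW d1))// ler_pdivlMr// mul1r.
apply: le_trans (ler_wpM2l (powR_ge0 _ _) (IH _ _ _ step)) _.
rewrite le_eqVlt; apply/orP; left; apply/eqP.
have -> : overlap (x - d) (y + d) (b w) (b w + r w) =
    r w * overlap ((x - b w) / r w - d / r w) ((y - b w) / r w + d / r w) 0 1.
  rewrite -(overlap_scale (r w) (b w))//.
  by congr overlap; field; rewrite ?lt0r_neq0.
rewrite !mulrA; congr (_ * _).
rewrite powRM ?invr_ge0 ?mulr_ge0 ?ltW// mulrCA; congr (_ * _).
rewrite -powR_inv1 ?ltW// -powRrM mulN1r opprB -powRD; last first.
  by apply/implyP => _; exact: lt0r_neq0.
by rewrite addrC subrK powRr1// ltW.
Qed.


(** The ball has length [4 * e], and thickening by [e] on both sides gives the factor 6. *)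
Lemma mass_ball_le s (F : set R) (x0 rmin rmax : R) n (u e : R) :
  let f w := similitude (r w) (b w) in let p w := r w `^ s in
  \sum_w p w = 1 -> 0 < s <= 1 ->
  (forall w, f w @` F `<=` F) -> F `<=` `[0, 1]%classic -> F x0 ->
  0 < rmin <= 1 -> (forall w, rmin <= r w <= rmax) ->
  0 < e <= 1 -> rmax ^+ n <= e ->
  transfer p f x0 n \1_(`[u - 2 * e, u + 2 * e]%classic) <=
  6 * rmin `^ (s - 1) * e `^ s.
Proof.
move=> f p p1 /andP[s0 s1] fF F01 Fx0 /andP[rmin0 rmin1] rr /andP[e0 e1] ne.
have ermin : rmax ^+ n <= e <= rmin^-1.
  by rewrite ne (le_trans e1)// invf_ge1.
apply: le_trans (mass_itv_le s F x0 rmin rmax n _ _ _ p1 s1 fF F01 Fx0 rmin0 rr ermin) _.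
have -> : 6 * rmin `^ (s - 1) * e `^ s = (rmin * e) `^ (s - 1) * (6 * e).
  by rewrite powRM ?ltW// -(mulr_powRB1 (ltW e0) s0); ring.
rewrite ler_wpM2l ?powR_ge0//; apply: le_trans (overlap_le _ _ _ _ _) _; lra.
Qed.

(** * Lower bound for the content *)

Lemma hausdorff_content_gt0 s t (F : set R) (rmin rmax : R) :
  let f w := similitude (r w) (b w) in let p w := r w `^ s in
  \sum_w p w = 1 -> 0 < s <= 1 -> t <= s ->
  (forall w, f w @` F `<=` F) -> F `<=` `[0, 1]%classic -> F !=set0 ->
  compact F ->
  0 < rmin <= 1 -> (forall w, rmin <= r w <= rmax) -> 0 <= rmax < 1 ->
  (0 < hausdorff_content t 1 F)%E.
Proof.
move=> f p p1 s01 ts fF F01 [x0 Fx0] Fc rmin01 rr rmax01.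
have /andP[s0 s1] := s01; have /andP[rmin0 rmin1] := rmin01.
pose K := 6 * rmin `^ (s - 1).
(* This keeps each [c i], and so each radius [e i], at most 1, as [mass_ball_le] requires. *)
have K1 : 1 <= K.
  suff : 1 <= rmin `^ (s - 1) by rewrite /K; lra.
  by rewrite -[leLHS](powRr0 rmin); apply: ger_powR; rewrite ?subr_le0// rmin0.
have K0 : 0 < K by exact: lt_le_trans K1.
apply: (@lt_le_trans _ _ (2 * K)^-1%:E).
  by rewrite lte_fin invr_gt0 mulr_gt0.
apply: le_ereal_inf_tmp => _ [U [FU dU] <-].
have /choice[q Uq] : forall i, exists q : R * R, [/\ 0 <= q.2 <= 1,
    U i `<=` `[q.1 - q.2, q.1 + q.2]%classic
    & ((q.2 `^ s)%:E <= diam_pow t (U i))%E].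
  by move=> i; exact: diam_pow_ball.
(* Radii [2 * e i] instead of [(q i).2] make the balls open and nondegenerate,
   and replacing [(q i).2] by [e i] adds at most [\sum_i c i <= (2 * K)^-1] to
   the sum of [s]-th powers. *)
pose c i := (2 * K)^-1 * 2^-1 ^+ i.+1.
pose e i := Num.max (q i).2 (c i `^ s^-1).
have c01 i : 0 < c i <= 1.
  have K2 : 0 < (2 * K)^-1 <= 1.
    have K20 : 0 < 2 * K by exact: mulr_gt0.
    by rewrite invr_gt0 K20 invf_le1//=; clearbody K; lra.
  have h2 : 0 < (2^-1 : R) ^+ i.+1 <= 1.
    by rewrite exprn_gt0 ?invr_gt0// exprn_ile1// ?invr_ge0// invf_le1// ler1n.
  have /andP[? ?] := K2; have /andP[? ?] := h2.
  by rewrite /c mulr_gt0// mulr_ile1// ltW.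
have e01 i : 0 < e i <= 1.
  have /andP[c0 c1] := c01 i; have [/andP[q0 q1] _ _] := Uq i.
  rewrite /e lt_max powR_gt0 ?orbT//= ge_max q1/=.
  have <- : 1 `^ s^-1 = 1 :> R by rewrite powR1.
  by rewrite ge0_ler_powR ?nnegrE ?invr_ge0// ?(ltW s0) ?(ltW c0).
have es i : e i `^ s <= (q i).2 `^ s + c i.
  have /andP[c0 c1] := c01 i.
  have cs : (c i `^ s^-1) `^ s = c i.
    by rewrite -powRrM mulVf ?gt_eqF// powRr1// ltW.
  rewrite /e maxEle; case: ifP => _; first by rewrite cs lerDr powR_ge0.
  by rewrite lerDl ltW.
have : finite_subset_cover setT
    (fun i => `](q i).1 - 2 * e i, (q i).1 + 2 * e i[%classic) F.
  move: Fc; rewrite compact_cover; apply => [i _|x Fx]; first exact: itv_open.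
  have [i _ Ux] := FU x Fx; exists i => //=.
  have [_ /(_ _ Ux)] := Uq i; rewrite /= !in_itv/= => /andP[l1 l2] _.
  have qe : (q i).2 <= e i by rewrite /e le_max lexx.
  by have /andP[e0 _] := e01 i; apply/andP; split; lra.
move=> [D _ FD].
pose N := (\max_(i <- finmap.enum_fset D) i).+1.
have {}FD x : F x -> exists2 i : 'I_N, true &
    `[(q i).1 - 2 * e i, (q i).1 + 2 * e i]%classic x.
  move=> /FD[i /= iD xi].
  have iN : (i < N)%N by rewrite ltnS;
      exact: (@leq_bigmax_seq _ (finmap.enum_fset D) xpredT id).
  exists (Ordinal iN) => //=; exact: subset_itv_oo_cc xi.
(* With finitely many radii left, a single level has cylinders smaller than all of them. *)
have [n ne] := exists_expr_le rmax (iota 0 N) e rmax01 (fun i => (andP (e01 i)).1).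
have mass : 1 <= \sum_(i < N) K * e i `^ s.
  rewrite -[leLHS](transfer_cst p f x0 n 1 p1).
  pose g (i : 'I_N) : R -> R :=
    \1_(`[(q i).1 - 2 * e i, (q i).1 + 2 * e i]%classic).
  apply: (@le_trans _ _ (transfer p f x0 n (fun x => \sum_(i < N) g i x))).
    apply: (@le_transfer _ _ _ _ F) => // [w|x Fx]; first exact: powR_ge0.
    have [i _ xi] := FD x Fx; rewrite (bigD1 i)//= {1}/g indicE mem_set//.
    by rewrite lerDl sumr_ge0// => j _; rewrite /g indicE ler0n.
  rewrite transfer_sum; apply: ler_sum => i _.
  by apply: (@mass_ball_le s F x0 rmin rmax) => //; apply: ne; rewrite mem_iota/= add0n.
have le_sum : (2 * K)^-1 <= \sum_(i < N) (q i).2 `^ s.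
  (* The enlargement costs at most half of the unit mass, so the other half bounds the sum below. *)
  have : 1 <= K * (\sum_(i < N) (q i).2 `^ s + (2 * K)^-1).
    apply: le_trans mass _; rewrite -mulr_sumr; apply: ler_wpM2l; first exact: ltW.
    apply: (@le_trans _ _ (\sum_(i < N) ((q i).2 `^ s + c i))); first exact: ler_sum.
    rewrite big_split/= lerD2l -mulr_sumr -[leRHS]mulr1 ler_wpM2l//.
      by rewrite invr_ge0 mulr_ge0// ltW.
    exact: sum_half_pow_le1.
  rewrite mulrDr; have -> : K * (2 * K)^-1 = 2^-1 by field; exact: lt0r_neq0.
  move=> h; rewrite [leLHS](_ : _ = 2^-1 / K); last by field; exact: lt0r_neq0.
  by rewrite ler_pdivrMr// [leRHS]mulrC; lra.
apply: (@le_trans _ _ (\sum_(0 <= i < N) diam_pow t (U i))%E).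
  rewrite big_mkord; apply: (@le_trans _ _ (\sum_(i < N) (q i).2 `^ s)%:E).
    by rewrite lee_fin.
  by rewrite -sumEFin; apply: lee_sum => i _; have [] := Uq i.
by apply: nneseries_lim_ge => i _ _; exact: diam_pow_ge0.
Qed.

(** * Cylinder covers and vanishing measure *)

(** The list holds left endpoints and lengths of the level [n] cylinders, obtained from [[0, 1]] by
    applying every map at each step; the sum of powers then factors. *)
Lemma exists_interval_cover t (F : set R) (rmax : R) n :
  let f w := similitude (r w) (b w) in
  F = \bigcup_(w in [set: A]) (f w @` F) -> F `<=` `[0, 1]%classic ->
  (forall w, r w <= rmax) ->
  exists l : seq (R * R),
    [/\ forall x, F x -> exists2 q, q \in l & q.1 <= x <= q.1 + q.2,
        forall q, q \in l -> 0 <= q.2 <= rmax ^+ n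
      & \sum_(q <- l) q.2 `^ t = (\sum_w r w `^ t) ^+ n].
Proof.
move=> f FE F01 rr; elim: n => [|n [l [Fl l0 lt]]].
  exists [:: (0, 1)]; split=> [x Fx|q|]; last by rewrite big_seq1 powR1 expr0.
    by exists (0, 1); rewrite ?mem_head// add0r; have := F01 x Fx; rewrite /= in_itv.
  by rewrite inE => /eqP ->; rewrite expr0 ler01 lexx.
exists [seq (r w * q.1 + b w, r w * q.2) | w <- index_enum A, q <- l].
split=> [x|q|].
- rewrite {1}FE => -[w _ [y /Fl[q ql /andP[q1 q2]] <-]].
  exists (r w * q.1 + b w, r w * q.2).
    by apply: allpairs_f => //; exact: mem_index_enum.
  by rewrite /f /similitude/= addrAC -mulrDr !lerD2r !ler_wpM2l ?q1 ?q2 ?ltW.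
- move=> /allpairsP[[w p] /= [_ pl ->]] /=.
  have /andP[p0 p1] := l0 p pl.
  by rewrite mulr_ge0 ?(ltW (r_gt0 w))//= exprS ler_pM// ltW.
- rewrite big_allpairs_dep/= exprS -lt mulr_suml; apply: eq_bigr => w _.
  rewrite mulr_sumr big_seq [RHS]big_seq; apply: eq_bigr => q ql.
  by have /andP[q0 _] := l0 q ql; rewrite powRM// ltW.
Qed.

Lemma hausdorff_measure_eq0 t (F : set R) (rmax : R) :
  let f w := similitude (r w) (b w) in
  F = \bigcup_(w in [set: A]) (f w @` F) -> F `<=` `[0, 1]%classic ->
  0 <= rmax < 1 -> (forall w, r w <= rmax) ->
  0 <= t -> \sum_w r w `^ t < 1 -> hausdorff_measure t F = 0%E.
Proof.
move=> f FE F01 rmax01 rr t0 sum1; apply/eqP; rewrite eq_le; apply/andP; split.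
  apply: ge_ereal_sup => _ [d /= d0 <-]; apply/lee_addgt0Pr => e e0.
  have sum01 : 0 <= \sum_w r w `^ t < 1.
    by rewrite sum1 sumr_ge0// => w _; exact: powR_ge0.
  have [n1 n1d] := exists_expr_le rmax [:: 0%N] (fun=> d) rmax01 (fun=> d0).
  have [n2 n2e] := exists_expr_le _ [:: 0%N] (fun=> e) sum01 (fun=> e0).
  have /andP[rm0 rm1] := rmax01; have /andP[sum0 _] := sum01.
  (* [n1] makes the cylinders shorter than the mesh [d], [n2] makes the sum at most [e]. *)
  pose n := maxn n1 n2.
  have nd : rmax ^+ n <= d.
    apply: le_trans (n1d 0%N (mem_head _ _)).
    by apply: ler_wiXn2l; rewrite ?(ltW rm1) ?leq_maxl.
  have ne : (\sum_w r w `^ t) ^+ n <= e.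
    apply: le_trans (n2e 0%N (mem_head _ _)).
    by apply: ler_wiXn2l; rewrite ?(ltW sum1) ?leq_maxr.
  have [l [Fl l0 lt]] := exists_interval_cover t F rmax n FE F01 rr.
  rewrite add0e; apply: (@le_trans _ _ (\sum_(q <- l) q.2 `^ t)%:E).
    apply: hausdorff_content_le_sum => // q /l0/andP[q0 qn].
    by rewrite q0 (le_trans qn).
  by rewrite lee_fin lt.
apply: le_trans (hausdorff_content_ge0 t 1 F) _.
apply: ereal_sup_ubound; exists 1 => //; exact: ltr01.
Qed.

End iterated_function_system.

(** * The similarity exponent and the dimension *)

Theorem theorem2 (R : realType) (A : finType) (r b : A -> R) (F : set R)
  (A_nonempty : (0 < #|A|)%N)
  (r_bounds : forall w : A, 0 < r w < 1)
  (b_bounds : forall w : A, 0 <= b w <= 1)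
  (f_maps : forall w : A,
    similitude (r w) (b w) @` `[0, 1]%classic `<=` `[0, 1]%classic)
  (F_sub : F `<=` `[0, 1]%classic)
  (F_self_similar : self_similar_set (fun w : A => similitude (r w) (b w)) F)
  (images_disjoint : forall w w' : A, w <> w' ->
    interior (similitude (r w) (b w) @` `[0, 1]%classic) `&`
    interior (similitude (r w') (b w') @` `[0, 1]%classic) = set0) :
  exists s : R,
    [/\ hausdorff_dim F = s%:E,
        0 <= s <= 1,
        \sum_(w : A) r w `^ s = 1
      & forall t : R, 0 <= t <= 1 -> \sum_(w : A) r w `^ t = 1 -> t = s].
Proof.
have [F0 Fc FE] := F_self_similar.
have fF w : similitude (r w) (b w) @` F `<=` F.
  by move=> x Fx; rewrite FE; exists w.
have /card_gt0P[w0 _] := A_nonempty.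
pose phi t := \sum_(w : A) r w `^ t.
have phi_lt x y : x < y -> phi y < phi x.
  move=> xy; rewrite /phi (bigD1 w0)//= [ltRHS](bigD1 w0)//=.
  apply: ltr_leD; first exact: ltr_powR_expnt.
  by apply: ler_sum => w _; apply/ltW/ltr_powR_expnt.
have phi_cont : continuous phi.
  move=> x; apply: cvg_big => [|w _]; first exact: add_continuous.
  by apply: continuous_powR_expnt; have /andP[] := r_bounds w.
have phi0 : 1 <= phi 0.
  rewrite /phi (bigD1 w0)//= powRr0 lerDl.
  by apply: sumr_ge0 => w _; exact: powR_ge0.
have phi1 : phi 1 <= 1.
  rewrite /phi; under eq_bigr => w _.
    rewrite powRr1; last by have /andP[/ltW] := r_bounds w.
    over.
  exact: sum_ratio_le1 r b r_bounds f_maps images_disjoint.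
have [s] : exists2 s, s \in `[0, 1] & phi s = 1.
  apply: IVT; [exact: ler01|exact: continuous_subspaceT|].
  by rewrite ge_min le_max phi0 phi1 orbT.
rewrite in_itv/= => s01 phis; have /andP[s0 s1] := s01.
(* The default values 1 and 0 give [rmin <= 1] and [0 <= rmax] at once. *)
pose rmin := \big[Num.min/1]_w r w; pose rmax := \big[Num.max/0]_w r w.
have rmin01 : 0 < rmin <= 1.
  rewrite bigmin_le_id andbT; apply: lt_bigmin => // w _.
  by have /andP[] := r_bounds w.
have rmax01 : 0 <= rmax < 1.
  apply/andP; split; first exact: bigmax_ge_id.
  by apply: bigmax_lt => // w _; have /andP[] := r_bounds w.
have rr w : rmin <= r w <= rmax by rewrite bigmin_le le_bigmax.
exists s; split => //; last first.
  move=> t _ phit; have [/phi_lt|/phi_lt|//] := ltgtP t s.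
    by rewrite phis [phi t]phit ltxx.
  by rewrite phis [phi t]phit ltxx.
apply/eqP; rewrite eq_le; apply/andP; split.
  (* Beyond [s] the strictly decreasing [phi] is below 1, so the measure vanishes at [s + e]. *)
  apply/lee_addgt0Pr => e e0; rewrite -EFinD.
  apply: ereal_inf_lbound; exists (s + e) => //; split; first by rewrite addr_ge0 ?(ltW e0).
  apply: (hausdorff_measure_eq0 r b r_bounds _ F rmax) => //.
  - by move=> w; have /andP[] := rr w.
  - by rewrite addr_ge0 ?(ltW e0).
  - by rewrite -[ltRHS]phis; apply: phi_lt; rewrite ltrDl.
apply: le_ereal_inf_tmp => _ [t [t0 Ht0] <-]; rewrite lee_fin leNgt.
apply/negP => ts.
(* The content at scale 1 is positive yet bounded by the null measure at [t]. The positivity of [s]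
   comes from [0 <= t < s], so [s = 0] is no separate case. *)
have := hausdorff_content_gt0 r b r_bounds f_maps images_disjoint s t F rmin rmax
  phis _ (ltW ts) fF F_sub F0 Fc rmin01 rr rmax01.
rewrite s1 (le_lt_trans t0 ts) => /(_ isT); apply/negP; rewrite -leNgt -Ht0.
apply: ereal_sup_ubound; exists 1 => //; exact: ltr01.
Qed.
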